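(* For every positive integer $n$, $$\frac{n}{2}\log_2\!\left(\frac{3n}{4}\right) \le b(n) \le f(n) \le \frac{n}{2}\log_2(n).$$
   Context: All graphs are finite and simple. A good edge-labelling of a graph $G$ is a map $\phi:E(G)\to\mathbb{R}$ such that for every ordered pair of vertices $(u,v)$ there is at most one nondecreasing path from $u$ to $v$, i.e. at most one path $u=v_0,v_1,\dots,v_t=v$ in $G$ with $\phi(v_0v_1)\le\phi(v_1v_2)\le\dots\le\phi(v_{t-1}v_t)$. A graph is good if it admits a good edge-labelling. $f(n)$ denotes the maximum number of edges of a good graph on $n$ vertices. $b(n)$ denotes the total number of $1$'s in the binary expansions of all integers from $0$ to $n-1$. *)

(* Defs.v *)
From HB Require Import structures.
From mathcomp Require Import all_boot all_order all_algebra.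
From mathcomp Require Import boolp reals exp.

Set Implicit Arguments.
Unset Strict Implicit.
Unset Printing Implicit Defensive.

Import Order.TTheory GRing.Theory Num.Theory.

Local Open Scope ring_scope.

(* A finite simple graph on the vertex set T is given by its edge set E, a set
   of two-element subsets of T; the edge between x and y is [set x; y]. *)
Definition simple_graph (T : finType) (E : {set {set T}}) : bool :=
  [forall e in E, #|e| == 2%N].

Definition adjacent (T : finType) (E : {set {set T}}) : rel T :=
  [rel x y | [set x; y] \in E].

(* The path v_0, ..., v_t is given by its first vertex v_0 = u and the sequence
   p = [:: v_1; ...; v_t].  A path does not repeat vertices. *)
Definition graph_path (T : finType) (E : {set {set T}}) (u v : T) (p : seq T) : bool :=
  [&& path (adjacent E) u p, uniq (u :: p) & last u p == v].

Definition path_labels (R : realType) (T : finType) (phi : {set T} -> R)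
    (u : T) (p : seq T) : seq R :=
  pairmap (fun x y => phi [set x; y]) u p.

Definition nondecreasing_path (R : realType) (T : finType) (E : {set {set T}})
    (phi : {set T} -> R) (u v : T) (p : seq T) : bool :=
  graph_path E u v p && sorted <=%R (path_labels phi u p).

(* Only the values of phi on the edges in E matter. *)
Definition good_labelling (R : realType) (T : finType) (E : {set {set T}})
    (phi : {set T} -> R) : Prop :=
  forall (u v : T) (p q : seq T),
    nondecreasing_path E phi u v p -> nondecreasing_path E phi u v q -> p = q.

Definition good_graph (R : realType) (T : finType) (E : {set {set T}}) : Prop :=
  exists phi : {set T} -> R, good_labelling E phi.

(* f(n), taking 'I_n as the vertex set.  The family over which the maximum is
   taken contains the empty graph. *)
Definition max_good_edges (R : realType) (n : nat) : nat :=
  (\max_(E : {set {set 'I_n}} | simple_graph E && `[< good_graph R E >]) #|E|)%N.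

(* The bits of m at positions i >= m are all 0, since m < 2 ^ m. *)
Definition binary_ones (m : nat) : nat :=
  (\sum_(i < m) (m %/ 2 ^ i) %% 2)%N.

(* b(n) *)
Definition total_binary_ones (n : nat) : nat :=
  (\sum_(m < n) binary_ones m)%N.

Definition log2 (R : realType) (x : R) : R := ln x / ln 2.

(* Main.v *)
(* Upper bound: order the edges by label and add them in reverse, tracking for
   each vertex [u] the set of vertices that [u] reaches along increasing paths.
   Adding the edge [xy] replaces the two sets of [x] and [y], disjoint by
   uniqueness of paths, by their union, so the product of the [n] cardinals grows by
   a factor of at least 4; it never exceeds [n ^ n].

   Lower bound: on the vertices [0, ..., n - 1], join two numbers that differ in
   exactly one bit and label the edge with the weight of this bit.  A
   nondecreasing path flips the differing bits of its endpoints in increasing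
   order, and there are [b(n)] edges, one for each 1 in each number. *)

Require Import Defs.
From HB Require Import structures.
From mathcomp Require Import all_boot all_order all_algebra.
From mathcomp Require Import boolp reals exp.
From mathcomp Require Import zify ring lra.

Set Implicit Arguments.
Unset Strict Implicit.
Unset Printing Implicit Defensive.

Import Order.TTheory GRing.Theory Num.Theory.

(** * Ordered paths in a list of edges, and the upper bound *)

Definition path_edges (T : finType) (u : T) (p : seq T) : seq {set T} :=
  pairmap (fun x y => [set x; y]) u p.

(** Positions in the list [s] stand in for labels: the path takes its edges in the order of [s]. The
    subsequence condition also forces each step to be an edge. *)
Definition ordered_path (T : finType) (s : seq {set T}) (u v : T) (p : seq T) : bool :=
  [&& uniq (u :: p), last u p == v & subseq (path_edges u p) s].

Definition unique_ordered_paths (T : finType) (s : seq {set T}) : Prop :=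
  forall u v p q, ordered_path s u v p -> ordered_path s u v q -> p = q.

(** An ordered path can use the head of the list only as its first step. The union over both ends of
    [e] covers taking [e] and skipping it. *)
Fixpoint reachable (T : finType) (s : seq {set T}) (u : T) : {set T} :=
  if s is e :: s' then
    if u \in e then \bigcup_(w in e) reachable s' w else reachable s' u
  else [set u].

Lemma ordered_path_cons (T : finType) (e : {set T}) s u v p :
  ordered_path s u v p -> ordered_path (e :: s) u v p.
Proof.
case/and3P=> up lp sp; apply/and3P; split=> //.
by apply: subseq_trans sp (subseq_cons _ _).
Qed.

Lemma unique_ordered_paths_behead (T : finType) (e : {set T}) s :
  unique_ordered_paths (e :: s) -> unique_ordered_paths s.
Proof.
by move=> U u v p q /(ordered_path_cons e) hp /(ordered_path_cons e); apply: U.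
Qed.

Lemma path_edges_cat (T : finType) (u : T) p q :
  path_edges u (p ++ q) = path_edges u p ++ path_edges (last u p) q.
Proof. exact: pairmap_cat. Qed.

(* If [q] visited [u], then [w] would reach [u] both along
   the edge [set u; w] and along an initial part of [q]. *)
Lemma ordered_path_extend (T : finType) (s : seq {set T}) u w v q :
  u != w -> [set u; w] \notin s -> unique_ordered_paths ([set u; w] :: s) ->
  ordered_path s w v q -> ordered_path ([set u; w] :: s) u v (w :: q).
Proof.
move=> uw es U hq; have /and3P[uq /eqP lq sq] := hq.
suff uNq : u \notin q.
  apply/and3P; split; rewrite /= ?lq ?eqxx //.
  by rewrite inE negb_or uw uNq.
apply/negP => uin.
case: (splitPr uin) uq lq sq {hq} => q1 q2 uq lq sq.
have /U : ordered_path ([set u; w] :: s) w u [:: u].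
  apply/and3P; split=> //=; first by rewrite inE eq_sym uw.
  by rewrite [[set w; u]]setUC eqxx sub0seq.
move=> /(_ (rcons q1 u)) h.
have hs : subseq (path_edges w (rcons q1 u)) s.
  apply: subseq_trans sq; rewrite -cat_rcons path_edges_cat.
  exact: prefix_subseq.
have /h eq1 : ordered_path ([set u; w] :: s) w u (rcons q1 u).
  apply: ordered_path_cons; apply/and3P; split; rewrite ?last_rcons //.
  by move: uq; rewrite -cat_rcons -cat_cons cat_uniq => /andP[].
move: hs; rewrite -eq1 /= sub1seq [[set w; u]]setUC => es'.
by rewrite es' in es.
Qed.

(** The recursion does not check for repeated vertices; [ordered_path_extend] shows that prepending
    an edge creates none. *)
Lemma reachableP (T : finType) (s : seq {set T}) u v :
  uniq s -> (forall e, e \in s -> #|e| = 2) -> unique_ordered_paths s ->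
  v \in reachable s u -> exists p, ordered_path s u v p.
Proof.
elim: s u => [|e s IH] u /=.
  move=> _ _ _ /set1P->; exists [::]; by rewrite /ordered_path /= eqxx.
case/andP=> es us s2 U.
have {}IH w : v \in reachable s w -> exists p, ordered_path s w v p.
  apply: IH => //; last exact: unique_ordered_paths_behead U.
  by move=> e' e's; apply: s2; rewrite inE e's orbT.
case: ifP => [ue /bigcupP[w we /IH[p hp]]|_ /IH[p hp]]; last first.
  by exists p; apply: ordered_path_cons.
have [<-|uw] := eqVneq w u; first by exists p; apply: ordered_path_cons.
have eE : e = [set u; w].
  apply/eqP; rewrite eq_sym eqEcard subUset !sub1set ue we /=.
  by rewrite s2 ?mem_head // cards2 eq_sym uw.
exists (w :: p); rewrite eE; apply: ordered_path_extend; rewrite -?eE //.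
by rewrite eq_sym.
Qed.

(* Adding the edge [set x; y] replaces the disjoint reachable sets of [x] and [y]
   by their union: sizes [a], [b] become [a + b], [a + b], and
   [4 a b <= (a + b) ^ 2]. *)
Lemma prod_reachable (T : finType) (s : seq {set T}) :
  uniq s -> (forall e, e \in s -> #|e| = 2) -> unique_ordered_paths s ->
  4 ^ size s <= \prod_u #|reachable s u|.
Proof.
elim: s => [|e s IH] /=; first by move=> *; rewrite prodn_gt0 // => u; rewrite cards1.
case/andP=> es us s2 U.
have Us := unique_ordered_paths_behead U.
have s2' e' : e' \in s -> #|e'| = 2 by move=> h; apply: s2; rewrite inE h orbT.
have {}IH := IH us s2' Us.
have /eqP/cards2P[x [y [xy eE]]] := s2 e (mem_head _ _).
(* To a common vertex [v], [x] would have a path within [s] and one starting with the new edge;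
   uniqueness would put this edge in [s]. *)
have dis : [disjoint reachable s x & reachable s y].
  apply/pred0P => v /=; apply/negP => /andP[].
  move=> /(reachableP us s2' Us)[p hp] /(reachableP us s2' Us)[q hq].
  rewrite eE in es U.
  have := ordered_path_extend xy es U hq.
  move/(U _ _ _ _ (ordered_path_cons [set x; y] hp)) => pE.
  case/and3P: hp => _ _; rewrite pE /= => /mem_subseq/(_ [set x; y]).
  by rewrite mem_head (negPf es) => /(_ isT).
have rE u : u \in e -> reachable (e :: s) u = reachable s x :|: reachable s y.
  by move=> /= ->; rewrite eE bigcup_setU !big_set1.
have xe : x \in e by rewrite eE !inE eqxx.
have ye : y \in e by rewrite eE !inE eqxx orbT.
have yx : y != x by rewrite eq_sym.
rewrite -[X in _ <= X]/(\prod_u #|reachable (e :: s) u|).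
rewrite (bigD1 x) // (bigD1 y) // !rE //.
rewrite (eq_bigr (fun u => #|reachable s u|)); last first.
  by move=> u /andP[/= ux uy]; rewrite eE !inE (negPf ux) (negPf uy).
rewrite cardsU; move: dis; rewrite -setI_eq0 => /eqP->; rewrite cards0 subn0.
rewrite (bigD1 x) //= (bigD1 y) //= in IH; move: IH => /=.
move: #|_| #|_| (\prod_(_ | _) _) => b a c IH.
rewrite expnS; apply: leq_trans (_ : 4 * (a * (b * c)) <= _).
  by rewrite leq_mul2l IH orbT.
rewrite !mulnA leq_mul2r -mulnA; apply/orP; right.
by rewrite mulnn nat_AGM2.
Qed.

Lemma ordered_path_nondecreasing (R : realType) (T : finType) (E : {set {set T}})
    (phi : {set T} -> R) s u v p :
  {subset s <= E} -> sorted (relpre phi <=%R) s ->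
  ordered_path s u v p -> nondecreasing_path E phi u v p.
Proof.
move=> sE ss /and3P[up lp sp]; rewrite /nondecreasing_path /graph_path up lp /= andbT.
apply/andP; split.
  have : {subset path_edges u p <= E} by move=> e /(mem_subseq sp)/sE.
  elim: p {up lp sp} u => //= w p IH u h.
  apply/andP; split; first exact: h (mem_head _ _).
  apply: IH => e he; apply: h.
  by rewrite inE he orbT.
have -> : path_labels phi u p = map phi (path_edges u p).
  rewrite /path_labels; elim: p {up lp sp} u => //= w p IH u.
  by rewrite IH.
rewrite sorted_map; apply: subseq_sorted sp ss.
by move=> a b c; apply: le_trans.
Qed.

(** Sorting by label breaks ties arbitrarily, but ordered paths of the sorted list are still
    nondecreasing, so they are unique. Each reachable set has at most [#|T|] elements. *)
Lemma good_graph_edges (R : realType) (T : finType) (E : {set {set T}}) :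
  simple_graph E -> good_graph R E -> 4 ^ #|E| <= #|T| ^ #|T|.
Proof.
move=> /'forall_implyP E2 [phi good].
pose s := sort (relpre phi <=%R) (enum E).
have sE e : (e \in s) = (e \in E) by rewrite mem_sort mem_enum.
have us : uniq s by rewrite sort_uniq enum_uniq.
have -> : #|E| = size s by rewrite size_sort cardE.
apply: leq_trans (prod_reachable us _ _) _.
- by move=> e; rewrite sE => /E2/eqP.
- have ss : sorted (relpre phi <=%R) s.
    by apply: sort_sorted => a b; apply: le_total.
  move=> u v p q hp hq; apply: (good u v);
    apply: ordered_path_nondecreasing ss _ => // e; by rewrite sE.
- rewrite -prod_nat_const; apply: leq_prod => u _; exact: max_card.
Qed.

Lemma max_good_edges_upper (R : realType) n : 0 < n ->
  4 ^ max_good_edges R n <= n ^ n.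
Proof.
move=> n0; rewrite /max_good_edges.
elim/big_ind: _ => [|a b ha hb|E /andP[E2 /asboolP gE]].
- by rewrite expn_gt0 n0.
- by rewrite /maxn; case: ifP.
- by have := good_graph_edges E2 gE; rewrite card_ord.
Qed.

(** * Binary digits and the count of ones *)

Definition bit (m i : nat) : bool := odd (m %/ 2 ^ i).

Lemma bit_small m i : m < 2 ^ i -> bit m i = false.
Proof. by move=> h; rewrite /bit divn_small. Qed.

(** Bit [i] is 0, so the addition produces no carry. *)
Lemma bit_addX m i j : ~~ bit m i -> bit (m + 2 ^ i) j = (i == j) (+) bit m j.
Proof.
rewrite /bit => mi; have [ij|ji|->] := ltngtP i j; last first.
- by rewrite divnDr // divnn expn_gt0 addn1.
- rewrite -(subnK (ltnW ji)) expnD divnDMl ?expn_gt0 // oddD.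
  by rewrite addFb oddX subn_eq0 leqNgt ji addbF.
(* The quotient by [2 ^ i] is even, so adding 1 to it preserves its half and hence all higher
   bits. *)
- rewrite -(subnKC ij) expnD expnSr -!mulnA !divnMA.
  rewrite divnDr // divnn expn_gt0 /= !divn2 -[X in X./2]/((_ + 1)%N).
  by rewrite addn1 /= uphalf_half (negPf mi).
Qed.

Lemma binary_onesE m k : m <= k -> binary_ones m = \sum_(i < k) bit m i.
Proof.
move=> mk; rewrite /binary_ones.
rewrite (big_ord_widen k (fun i => (m %/ 2 ^ i) %% 2)) // big_mkcond.
apply: eq_bigr => i _; rewrite modn2; case: ltnP => // mi.
by rewrite bit_small // (leq_ltn_trans mi) // ltn_expl.
Qed.

Lemma binary_ones_addX m k :
  m < 2 ^ k -> binary_ones (2 ^ k + m) = (binary_ones m).+1.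
Proof.
move=> mk; rewrite (binary_onesE (leqnn _)).
rewrite (binary_onesE (leq_addl (2 ^ k) m)).
have kK : k < 2 ^ k + m by rewrite ltn_addr // ltn_expl.
pose k' := Ordinal kK.
have bE i : bit (2 ^ k + m) i = (k == i) (+) bit m i.
  by rewrite addnC bit_addX // bit_small.
rewrite (bigD1 k') //= [in RHS](bigD1 k') //= bE bit_small // eqxx /=.
rewrite add1n add0n; congr _.+1.
apply: eq_bigr => i ik; rewrite bE.
by rewrite -[k == i]/(k' == i) eq_sym (negPf ik).
Qed.

(** Each [2 ^ k + m] with [m < r] has one more 1 than [m], at position [k]; this gives the middle
    term [r]. *)
Lemma total_binary_ones_addX k r : r <= 2 ^ k ->
  total_binary_ones (2 ^ k + r) = total_binary_ones (2 ^ k) + r + total_binary_ones r.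
Proof.
move=> rk; rewrite /total_binary_ones big_split_ord /= -addnA; congr (_ + _).
rewrite (eq_bigr (fun m : 'I_r => 1 + binary_ones m)).
  by rewrite big_split /= sum1_card card_ord.
by move=> m _; rewrite binary_ones_addX // (leq_trans (ltn_ord m)).
Qed.

Lemma total_binary_onesX k : (total_binary_ones (2 ^ k)).*2 = k * 2 ^ k.
Proof.
elim: k => [|k IH]; first by rewrite /total_binary_ones big_ord1 /binary_ones big_ord0.
rewrite expnS mul2n -[(2 ^ k).*2]addnn total_binary_ones_addX //.
by rewrite !doubleD IH; lia.
Qed.

(** * The graph of one-bit flips and its number of edges *)

Definition flip (i x y : nat) : bool :=
  bit x i && (y == x - 2 ^ i) || bit y i && (x == y - 2 ^ i).

Lemma flipC i x y : flip i x y = flip i y x.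
Proof. exact: orbC. Qed.

Lemma bit_leqX x i : bit x i -> 2 ^ i <= x.
Proof. by apply: contraTT; rewrite -ltnNge => /bit_small->. Qed.

Lemma bit_subX x i j : bit x i -> bit (x - 2 ^ i) j = (i == j) (+) bit x j.
Proof.
move=> xi; have le := bit_leqX xi.
have nb : ~~ bit (x - 2 ^ i) i.
  by move: xi; rewrite /bit -{1}(subnK le) divnDr // divnn expn_gt0 addn1.
by rewrite -[in RHS](subnK le) bit_addX // addKb.
Qed.

Lemma bit_flip i x y j : flip i x y -> bit y j = (i == j) (+) bit x j.
Proof.
case/orP=> /andP[b /eqP->]; first exact: bit_subX.
by rewrite bit_subX // addKb.
Qed.

Lemma flip_distn i x y : flip i x y -> (x - y) + (y - x) = 2 ^ i.
Proof. by case/orP=> /andP[/bit_leqX le /eqP->]; lia. Qed.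

(** Bit [i] of [x] decides whether the flip adds or subtracts [2 ^ i]. *)
Lemma flip_inj i x y z : flip i x y -> flip i x z -> y = z.
Proof.
move=> xy xz; have := bit_flip i xy; have := bit_flip i xz; rewrite eqxx /=.
move: xy xz.
case/orP=> /andP[b /eqP E]; case/orP=> /andP[b' /eqP E'].
- by rewrite E E'.
- by rewrite b b'.
- by rewrite b b'.
- by have := bit_leqX b; have := bit_leqX b'; lia.
Qed.

Definition clear_bit n (x : 'I_n) (i : nat) : 'I_n :=
  Ordinal (leq_ltn_trans (leq_subr (2 ^ i) x) (ltn_ord x)).

(** An induced subgraph of the hypercube, each edge being generated from its larger end. Positions
    below [n] suffice, since a 1 at position [i] of [x] gives [i < 2 ^ i <= x < n]. *)
Definition cube_edges n : {set {set 'I_n}} :=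
  [set [set xi.1; clear_bit xi.1 xi.2] | xi : 'I_n * 'I_n & bit xi.1 xi.2].

(* Subtraction is truncated, so the length of [set x; y] is the distance |x - y|. *)
Definition edge_length (R : realType) n (e : {set 'I_n}) : R :=
  (\sum_(x in e) \sum_(y in e) (x - y))%N%:R%R.

Lemma big_set2 (T : finType) (x y : T) (F : T -> nat) : x != y ->
  \sum_(z in [set x; y]) F z = F x + F y.
Proof. by move=> xy; rewrite big_setU1 ?inE // big_set1. Qed.

Lemma flip_neq n i (x y : 'I_n) : flip i x y -> x != y.
Proof. by move=> /(bit_flip i); apply: contraPneq => ->; rewrite eqxx; case: bit. Qed.

Lemma edge_length_flip (R : realType) n i (x y : 'I_n) : flip i x y ->
  edge_length R [set x; y] = (2 ^ i)%:R%R.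
Proof.
move=> xy; have nxy := flip_neq xy.
by rewrite /edge_length !big_set2 // !subnn add0n addn0 (flip_distn xy).
Qed.

Lemma adjacent_cube n (x y : 'I_n) :
  adjacent (cube_edges n) x y -> exists i, flip i x y.
Proof.
case/imsetP=> -[z i]; rewrite inE /= => b E.
have /setP/(_ x) := E; have /setP/(_ y) := E.
have fz : flip i z (clear_bit z i) by rewrite /flip b /= eqxx.
have zn := flip_neq fz.
have : #|[set x; y]| = 2 by rewrite E cards2 zn.
rewrite cards2; case: eqVneq => // xy _.
rewrite !inE !eqxx orbT.
case/esym/orP => /eqP Ey /esym/orP[] /eqP Ex; move: xy; rewrite Ex Ey ?eqxx // => _.
- by exists i; rewrite flipC.
- by exists i.
Qed.

Lemma simple_cube n : simple_graph (cube_edges n).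
Proof.
apply/'forall_implyP => e /imsetP[[z i]]; rewrite inE /= => b ->.
by rewrite cards2 (@flip_neq _ i) // /flip b /= eqxx.
Qed.

(** An edge determines the pair generating it: [x] is its larger end and [2 ^ i] the distance
    between its ends. *)
Lemma card_cube n : #|cube_edges n| = total_binary_ones n.
Proof.
rewrite card_in_imset.
  rewrite -sum1dep_card.
  rewrite -(pair_big_dep xpredT (fun x i : 'I_n => bit x i) (fun _ _ => 1)) /=.
  apply: eq_bigr => x _; rewrite (binary_onesE (ltnW (ltn_ord x))) big_mkcond.
  by apply: eq_bigr => i _; case: bit.
move=> [x i] [y j]; rewrite !inE /= => bx by_ E.
have /setP/(_ x) := E; have /setP/(_ y) := E; rewrite !inE !eqxx /= -!val_eqE /=.
have lx := bit_leqX bx; have ly := bit_leqX by_.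
have p0 k : 0 < 2 ^ k by rewrite expn_gt0.
move=> h1 h2; have exy : x = y.
  apply: val_inj => /=; move: (p0 i) (p0 j).
  case/orP: h1 => [/eqP|]; first by move->.
  case/orP: (esym h2) => [/eqP|] //.
  by lia.
subst y; congr (_, _).
have fi : flip i x (clear_bit x i) by rewrite /flip bx /= eqxx.
have fj : flip j x (clear_bit x j) by rewrite /flip by_ /= eqxx.
have /setP/(_ (clear_bit x i)) := E; rewrite !inE eqxx orbT => /esym/orP[].
  by rewrite eq_sym (negPf (flip_neq fi)).
move=> /eqP E'; rewrite E' in fi.
apply: val_inj => /=; have := flip_distn fi; rewrite (flip_distn fj).
by move/eqP; rewrite eqn_exp2l // => /eqP->.
Qed.

(** * Uniqueness of nondecreasing paths in the cube graph *)

Local Open Scope ring_scope.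

(** A label above [2 ^ i] belongs to a flip of a bit above [i]. *)
Lemma bit_last (R : realType) n (u : 'I_n) p i :
  path (adjacent (cube_edges n)) u p ->
  all (fun l => (2 ^ i)%:R < l) (path_labels (@edge_length R n) u p) ->
  bit (last u p) i = bit u i.
Proof.
elim: p u => //= x p IH u /andP[/adjacent_cube[j f] pp] /andP[].
rewrite (edge_length_flip _ f) ltr_nat ltn_exp2l // => ij /IH -> //.
by rewrite (bit_flip _ f) gtn_eqF.
Qed.

(** A second label [2 ^ i] would flip the same bit back and return to [u], which the path avoids; so
    the labels after the first step are strictly larger. *)
Lemma labels_gt (R : realType) n (u x : 'I_n) p i :
  path (adjacent (cube_edges n)) x p -> u \notin p -> flip i u x ->
  sorted <=%R (path_labels (@edge_length R n) u (x :: p)) ->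
  all (fun l => (2 ^ i)%:R < l) (path_labels (@edge_length R n) x p).
Proof.
case: p => //= y p /andP[/adjacent_cube[j f] pp]; rewrite inE negb_or => /andP[uy _] fi.
rewrite (edge_length_flip _ f) (edge_length_flip _ fi) ler_nat leq_exp2l //.
rewrite ltr_nat ltn_exp2l // => /andP[ij h].
have lt_ij : (i < j)%N.
  rewrite ltn_neqAle ij andbT; apply: contraNneq uy => E; subst j.
  by apply/eqP/val_inj; rewrite flipC in fi; apply: flip_inj fi f.
rewrite lt_ij /=; have := order_path_min le_trans h.
apply: sub_all => l; apply: lt_le_trans.
by rewrite ltr_nat ltn_exp2l.
Qed.

Lemma cube_good (R : realType) n : good_labelling (cube_edges n) (@edge_length R n).
Proof.
move=> u v p q /andP[/and3P[ap up /eqP lp] sp] /andP[/and3P[aq uq /eqP lq] sq].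
move: lq; rewrite -lp => {lp v}.
elim: p u q ap up sp aq uq sq => [|x p IH] u [|y q] //.
- by move=> _ _ _ _ /andP[/negP uq _] _ /= E; case: uq; rewrite -E mem_last.
- by move=> _ /andP[/negP uq _] _ _ _ _ /= E; case: uq; rewrite E mem_last.
(* The smallest flipped bit is read off from the endpoints. *)
have key (a b : 'I_n) (r t : seq 'I_n) i j : path (adjacent (cube_edges n)) a r ->
    u \notin r -> flip i u a ->
    sorted <=%R (path_labels (@edge_length R n) u (a :: r)) ->
    path (adjacent (cube_edges n)) u (b :: t) -> flip j u b ->
    sorted <=%R (path_labels (@edge_length R n) u (b :: t)) ->
    last a r = last b t -> (j <= i)%N.
  (* If [i < j], the path through [a] flips bit [i] exactly once, while all labels of the path
     through [b] exceed [2 ^ i]; the common end would have two values of bit [i]. *)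
  move=> ar ur fi sr pt fj st E; rewrite leqNgt; apply/negP => ij.
  have := bit_last ar (labels_gt ar ur fi sr); rewrite E.
  have := @bit_last R n u (b :: t) i pt; rewrite [last _ _]/= => ->.
    by rewrite (bit_flip _ fi) eqxx; case: bit.
  move: st; rewrite /= (edge_length_flip _ fj) => st.
  rewrite ltr_nat ltn_exp2l // ij /=; have := order_path_min le_trans st.
  apply: sub_all => l; apply: lt_le_trans.
  by rewrite ltr_nat ltn_exp2l.
move=> ap up sp aq uq sq E.
have /andP[/adjacent_cube[i fi] ap'] := ap.
have /andP[/adjacent_cube[j fj] aq'] := aq.
have /andP[] := up; rewrite inE negb_or => /andP[_ ux] up'.
have /andP[] := uq; rewrite inE negb_or => /andP[_ uy] uq'.
have ij : i = j.
  apply/eqP; rewrite eqn_leq (key _ _ _ _ _ _ ap' ux fi sp aq fj sq (esym E)).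
  by rewrite (key _ _ _ _ _ _ aq' uy fj sq ap fi sp E).
subst j; have xy : x = y by apply: val_inj; apply: flip_inj fi fj.
subst y; congr (_ :: _); apply: (IH x) => //.
- exact: path_sorted sp.
- exact: path_sorted sq.
Qed.

Lemma max_good_edges_lower (R : realType) n :
  (total_binary_ones n <= max_good_edges R n)%N.
Proof.
rewrite -card_cube; apply: (@leq_bigmax_cond _ _ (fun E : {set {set 'I_n}} => #|E|)).
by rewrite simple_cube; apply/asboolP; exists (@edge_length R n); apply: cube_good.
Qed.

(** * Logarithmic lower bound on the count of ones *)

Lemma ln_tangent (R : realType) (a b : R) : 0 < a -> 0 < b ->
  b * ln a <= b * ln b + a - b.
Proof.
move=> a0 b0.
have h : -1 < a / b - 1 by have := divr_gt0 a0 b0; lra.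
have := le_ln1Dx h; rewrite addrC subrK ln_div ?posrE // => {}h.
have ab : a - b = b * (a / b - 1) by field; rewrite gt_eqF.
have : b * (ln a - ln b) <= a - b by rewrite ab ler_pM2l.
lra.
Qed.

(* Writing [n = 2 ^ k + r] with [0 <= r < 2 ^ k], the induction step is the
   log-sum inequality, obtained from the tangents to [ln] at [2 ^ k] and [3 r]. *)
Lemma total_binary_ones_lower (R : realType) (n : nat) : (0 < n)%N ->
  n%:R * ln (3 * n%:R / 4) <= (total_binary_ones n).*2%:R * ln 2 :> R.
Proof.
elim/ltn_ind: n => n IH n0.
have L4 : ln 4 = 2 * ln 2 :> R.
  by rewrite (_ : 4 = 2 ^+ 2 :> R) ?lnXn // ?mulr_natl //; ring.
pose k := trunc_log 2 n; pose r := (n - 2 ^ k)%N.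
have kn : (2 ^ k <= n)%N by apply: trunc_logP.
have nk : (n < 2 ^ k.+1)%N by apply: trunc_log_ltn.
have nE : n = (2 ^ k + r)%N by rewrite /r subnKC.
have rk : (r < 2 ^ k)%N by rewrite expnS in nk; lia.
have rn : (r < n)%N by rewrite nE -addn1 addnC leq_add2r expn_gt0.
rewrite nE total_binary_ones_addX 1?ltnW // !doubleD total_binary_onesX.
rewrite !natrD !natrM.
have : ln (2 ^ k)%:R = k%:R * ln 2 :> R by rewrite natrX lnXn // mulr_natl.
have N0 : 0 < (2 ^ k)%:R :> R by rewrite ltr0n expn_gt0.
move: (2 ^ k)%:R N0 => N N0 lnN.
(* For [r = 0] the induction hypothesis does not apply; the tangent at [N] alone suffices, with
   slack [N / 4]. *)
have [r0|r0] := posnP r.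
  have := @ln_tangent R (3 * N / 4) N.
  rewrite r0 addr0 lnN => /(_ _ N0) h.
  have {}h := h ltac:(lra).
  have : 0 <= (total_binary_ones 0).*2%:R * ln 2 :> R.
    by rewrite mulr_ge0 // ln_ge0 //; lra.
  rewrite -[0.*2]/0%N; lra.
have r0' : 0 < r%:R :> R by rewrite ltr0n.
have := IH _ rn r0.
rewrite -[r.*2]muln2 natrM.
move: r%:R r0' => x x0.
rewrite !lnM ?posrE ?invr_gt0 ?mulr_gt0 ?addr_gt0 // lnV ?posrE // L4.
(* In the tangent at [N] plus one third of the tangent at [3 * x], the linear terms cancel. Passing
   from [ln (3 * x)] to the [ln (3 * x / 4)] of the induction hypothesis costs [2 * x * ln 2], which
   the doubled [r] pays for. *)
have := @ln_tangent R (3 * (N + x) / 4) N ltac:(lra) N0.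
have := @ln_tangent R (3 * (N + x) / 4) (3 * x) ltac:(lra) ltac:(lra).
rewrite !lnM ?posrE ?invr_gt0 ?mulr_gt0 ?addr_gt0 // lnV ?posrE // L4 lnN.
lra.
Qed.

Theorem theorem1 (R : realType) (n : nat) (n_gt0 : (0 < n)%N) :
  [/\ n%:R / 2 * log2 (3 * n%:R / 4) <= (total_binary_ones n)%:R :> R,
      (total_binary_ones n <= max_good_edges R n)%N
    & (max_good_edges R n)%:R <= n%:R / 2 * log2 n%:R :> R].
Proof.
have ln2_gt0 : 0 < ln 2 :> R by rewrite ln_gt0 // ltr1n.
rewrite /log2; split; last 2 first.
- exact: max_good_edges_lower.
- have := max_good_edges_upper R n_gt0; move: (max_good_edges R n) => m.
  rewrite -[4%N]/(2 ^ 2)%N -expnM -(ler_nat R) !natrX => le_mn.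
  have {le_mn} : ln (2 ^+ (2 * m)) <= ln (n%:R ^+ n) :> R.
    by rewrite ler_ln // posrE exprn_gt0 // ltr0n.
  rewrite !lnXn ?ltr0n // -[ln 2 *+ _]mulr_natl -[ln _ *+ n]mulr_natl natrM => le_mn.
  by rewrite mulrA ler_pdivlMr //; lra.
- have := total_binary_ones_lower R n_gt0; move: (total_binary_ones n) => b.
  rewrite -muln2 natrM => le_n.
  by rewrite mulrA ler_pdivrMr //; lra.
Qed.
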